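(* Let $s\ge r\ge 2$, let $Q$ be an $s$-vertex $r$-graph and let $\mathcal P$ be a hereditary property of $r$-graphs. Then for every $p>1$, $$\lambda^{(p)}(Q,\mathcal P)=\pi(Q,\mathcal P).$$
   Context: An $r$-graph ($r\ge 2$) is a finite hypergraph all of whose edges have exactly $r$ vertices. For $I\subseteq V(H)$, $H[I]$ denotes the induced subhypergraph on $I$. For an $s$-vertex $r$-graph $Q$ and an $r$-graph $H$, $\mathcal N(Q,H)$ is the number of (not necessarily induced) subgraphs of $H$ isomorphic to $Q$. For an $n$-vertex $r$-graph $H$ with vertex set $[n]$ and $\mathbf x\in\mathbb R^n$, $P_{Q,H}(\mathbf x)=s!\sum_{\{i_1,\dots,i_s\}\in\binom{[n]}{s}}\mathcal N(Q,H[\{i_1,\dots,i_s\}])\,x_{i_1}\cdots x_{i_s}$, and for $p\ge1$, $\lambda^{(p)}(Q,H)=\max_{\|\mathbf x\|_p=1}P_{Q,H}(\mathbf x)$. A hereditary property $\mathcal P$ of $r$-graphs is a family of $r$-graphs closed under isomorphism and under taking induced subgraphs; as a standing assumption, whenever $H\in\mathcal P$, the disjoint union of $H$ with an isolated vertex is also in $\mathcal P$. $\mathcal P_n$ is the set of members of $\mathcal P$ with $n$ vertices. $ex(Q,\mathcal P_n)=\max\{\mathcal N(Q,H):H\in\mathcal P_n\}$ and $\pi(Q,\mathcal P)=\lim_{n\to\infty}ex(Q,\mathcal P_n)/\binom ns$ (this limit exists). $\lambda^{(p)}(Q,\mathcal P_n)=\max\{\lambda^{(p)}(Q,H):H\in\mathcal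 P_n\}$ and $\lambda^{(p)}(Q,\mathcal P)=\lim_{n\to\infty}\lambda^{(p)}(Q,\mathcal P_n)n^{s/p-s}$ (this limit exists). *)

(* Defs.v *)
From HB Require Import structures.
From mathcomp Require Import all_boot all_order all_algebra all_fingroup.
From mathcomp Require Import all_classical all_reals all_analysis.
Set Implicit Arguments. Unset Strict Implicit. Unset Printing Implicit Defensive.
Import Order.TTheory GRing.Theory Num.Theory.
Local Open Scope ring_scope.

(* An r-graph on vertex set [n] = 'I_n is given by its edge set
   E : {set {set 'I_n}} with every edge of size r. *)
Definition uniform (T : finType) (r : nat) (E : {set {set T}}) : bool :=
  [forall e in E, #|e| == r].

Definition copies (T : finType) (s : nat) (Q : {set {set 'I_s}})
    (V : {set T}) (E : {set {set T}}) : {set {set T} * {set {set T}}} :=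
  [set WF : {set T} * {set {set T}} |
    [&& WF.1 \subset V, WF.2 \subset E &
      [exists f : {ffun 'I_s -> T},
        [&& injectiveb f, [set f i | i : 'I_s] == WF.1 &
            WF.2 == [set [set f i | i in e] | e : {set 'I_s} in Q]]]]].

Definition Ncopies (T : finType) (s : nat) (Q : {set {set 'I_s}})
    (V : {set T}) (E : {set {set T}}) : nat := #|copies Q V E|.

Definition induced (T : finType) (I : {set T}) (E : {set {set T}}) :
  {set {set T}} := [set e in E | e \subset I].

Definition PQH (R : realType) (n s : nat) (Q : {set {set 'I_s}})
    (E : {set {set 'I_n}}) (x : 'I_n -> R) : R :=
  (s`!)%:R * \sum_(I : {set 'I_n} | #|I| == s)
     (Ncopies Q I (induced I E))%:R * \prod_(i in I) x i.

Definition pnorm (R : realType) (n : nat) (p : R) (x : 'I_n -> R) : R :=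
  (\sum_i `|x i| `^ p) `^ p^-1.

(* lambda^{(p)}(Q, H) = max_{||x||_p = 1} P_{Q,H}(x) (the max exists;
   we write it as a supremum) *)
Definition lambda_p (R : realType) (n s : nat) (Q : {set {set 'I_s}})
    (E : {set {set 'I_n}}) (p : R) : R :=
  sup [set PQH Q E x | x in [set x : 'I_n -> R | pnorm p x = 1]]%classic.

Definition property := forall n : nat, {set {set 'I_n}} -> Prop.

(* the r-graph on [m] obtained from E by pulling back along f : [m] -> [n];
   for injective f this is H[f([m])] relabelled to [m] *)
Definition pullback (m n : nat) (f : 'I_m -> 'I_n) (E : {set {set 'I_n}}) :
  {set {set 'I_m}} := [set e : {set 'I_m} | [set f i | i in e] \in E].

Definition add_isolated (n : nat) (E : {set {set 'I_n}}) :
  {set {set 'I_n.+1}} := [set [set widen_ord (leqnSn n) i | i in e] | e : {set 'I_n} in E].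

Definition hereditary_property (r : nat) (P : property) : Prop :=
  [/\ (forall n E, P n E -> uniform r E),
      (forall n (sigma : {perm 'I_n}) E, P n E -> P n [set [set sigma i | i in e] | e : {set 'I_n} in E]),
      (forall m n (f : 'I_m -> 'I_n) E, injective f -> P n E -> P m (pullback f E))
    & (* standing assumption: adding an isolated vertex *)
      (forall n E, P n E -> P n.+1 (add_isolated E))].

Definition ex_n (R : realType) (s : nat) (Q : {set {set 'I_s}}) (P : property)
    (n : nat) : R :=
  sup [set (Ncopies Q [set: 'I_n]%SET E)%:R | E in [set E | P n E]]%classic.

Definition lambda_Pn (R : realType) (s : nat) (Q : {set {set 'I_s}})
    (P : property) (p : R) (n : nat) : R :=
  sup [set lambda_p Q E p | E in [set E | P n E]]%classic.

(* Main.v *)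
(* Write [a_n = ex(Q, P_n) / 'C(n, s)] and [b_n = lambda^(p)(Q, P_n) n^(s/p - s)].
   The constant vector gives [b_n >= a_n n^_s / n^s]. Conversely, for a
   probability vector [y] on the vertices of [H], sample [m] vertices
   independently from [y]: unless two of them collide, they span a member of
   [P_m], so that [P_{Q,H}(y) <= a_m + C m^2 max y]. If [x >= 0] has unit p-norm,
   then [x <= 1] and its sum [X] satisfies [1 <= X <= S := n^(1 - 1/p)]; applying
   this to [y = x / X], for which [max y <= 1 / X], gives
   [b_n <= a_m + C m^2 / S]. As [S] tends to infinity because [p > 1], both
   sequences converge to the infimum of the [a_m], [m >= s].

   Copies are counted through embeddings, i.e. injective maps sending edges to
   edges: a copy is an embedding up to the automorphisms of [Q]. *)
Require Import Defs.
From HB Require Import structures.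
From mathcomp Require Import all_boot all_order all_algebra all_fingroup.
From mathcomp Require Import all_classical all_reals all_analysis.
From mathcomp Require Import ring lra.
Import Order.TTheory GRing.Theory Num.Theory numFieldNormedType.Exports.
Set Implicit Arguments.
Unset Strict Implicit.
Unset Printing Implicit Defensive.
Local Open Scope ring_scope.

(** * Embeddings, copies and automorphisms *)

Definition embeddings (T : finType) (s : nat) (Q : {set {set 'I_s}})
    (E : {set {set T}}) : {set {ffun 'I_s -> T}} :=
  [set f : {ffun 'I_s -> T} | injectiveb f & [forall e in Q, f @: e \in E]].

Definition automorphisms (s : nat) (Q : {set {set 'I_s}}) : {set {perm 'I_s}} :=
  [set g : {perm 'I_s} | [set g @: e | e : {set 'I_s} in Q] == Q].

Lemma embeddingsP (T : finType) (s : nat) (Q : {set {set 'I_s}})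
    (E : {set {set T}}) (f : {ffun 'I_s -> T}) :
  reflect (injective f /\ forall e, e \in Q -> f @: e \in E)
          (f \in embeddings Q E).
Proof.
rewrite inE; apply: (iffP andP) => -[].
  by move=> /injectiveP fi /forall_inP.
by move=> /injectiveP fi fQ; split=> //; apply/forall_inP.
Qed.

Lemma card_automorphisms_gt0 (s : nat) (Q : {set {set 'I_s}}) :
  (0 < #|automorphisms Q|)%N.
Proof.
apply/card_gt0P; exists 1%g; rewrite inE.
rewrite (eq_imset (g := id)) ?imset_id // => e.
by rewrite (eq_imset (g := id)) ?imset_id // => i; rewrite perm1.
Qed.

Lemma same_image_perm (s : nat) (T : finType) (f g : 'I_s -> T) :
  injective f -> injective g -> g @: [set: 'I_s] = f @: [set: 'I_s] ->
  exists u : {perm 'I_s}, g =1 f \o u.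
Proof.
move=> fi gi fgE.
have fP k : {j | f j = g k}.
  apply: cid; have /imsetP[j _ ->] : g k \in f @: [set: 'I_s].
    by rewrite -fgE imset_f // inE.
  by exists j.
have ui : injective (fun k => sval (fP k)).
  by move=> j k e; apply: gi; rewrite -(svalP (fP j)) -(svalP (fP k)) e.
by exists (perm ui) => k; rewrite /= permE (svalP (fP k)).
Qed.

(* Two embeddings have the same image copy iff they differ by an automorphism. *)
Lemma card_embeddings_in (T : finType) (s : nat) (Q : {set {set 'I_s}})
    (V : {set T}) (E : {set {set T}}) :
  #|[set f in embeddings Q E | f @: [set: 'I_s] \subset V]|
    = (#|automorphisms Q| * Ncopies Q V E)%N.
Proof.
pose F (f : {ffun 'I_s -> T}) := (f @: [set: 'I_s], [set f @: e | e : {set 'I_s} in Q]).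
set D := [set f in _ | _].
have imT (f : {ffun 'I_s -> T}) : [set f i | i : 'I_s] = f @: [set: 'I_s].
  by apply/setP => y; apply/imsetP/imsetP => -[i _ ->]; exists i; rewrite ?inE.
have -> : Ncopies Q V E = #|F @: D|.
  congr #|pred_of_set _|; apply/setP => -[W G]; rewrite inE /=; apply/idP/imsetP.
    case/and3P => WV GE /existsP[f /and3P[fi /eqP WE /eqP GE']].
    exists f; last by rewrite /F GE' -WE imT.
    rewrite inE -imT WE WV andbT; apply/embeddingsP; split; first exact/injectiveP.
    by move=> e eQ; apply: (fintype.subsetP GE); rewrite GE'; apply/imsetP; exists e.
  case=> f; rewrite inE => /andP[/embeddingsP[fi fQ] fV] [-> ->].
  rewrite fV /=; apply/andP; split.
    by apply/fintype.subsetP => _ /imsetP[e eQ ->]; apply: fQ.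
  by apply/existsP; exists f; rewrite imT !eqxx !andbT; apply/injectiveP.
rewrite -sum1_card (partition_big_imset F) /= mulnC -sum_nat_const.
apply: eq_bigr => _ /imsetP[f fD ->]; rewrite sum1_card.
move: (fD); rewrite inE => /andP[/embeddingsP[fi fQ] fV].
(* The fibre of [F] through [f] is parameterised by the maps [f \o u] with [u] an automorphism of
   [Q]. *)
pose c (u : {perm 'I_s}) : {ffun 'I_s -> T} := [ffun i => f (u i)].
have cimg (u : {perm 'I_s}) (e : {set 'I_s}) : c u @: e = f @: (u @: e).
  by rewrite -imset_comp; apply: eq_imset => i; rewrite ffunE.
have ci : injective c.
  move=> u v uv; apply/permP => i; apply: fi.
  by have := congr1 (fun g : {ffun _} => g i) uv; rewrite !ffunE.
have cT (u : {perm 'I_s}) : c u @: [set: 'I_s] = f @: [set: 'I_s].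
  rewrite cimg (_ : u @: _ = [set: 'I_s]) //; apply/eqP.
  by rewrite eqEcard finset.subsetT (card_imset _ (@perm_inj _ u)) leqnn.
have cE (u : {perm 'I_s}) : [set c u @: e | e : {set 'I_s} in Q]
    = [set f @: (e : {set 'I_s}) | e in [set u @: (e : {set 'I_s}) | e in Q]].
  by rewrite -imset_comp; apply: eq_imset => e /=; rewrite cimg.
rewrite -(card_imset _ ci); apply: eq_card => g; apply/andP/imsetP.
  rewrite inE => -[/andP[/embeddingsP[gi gQ] gV] /eqP[gT gE]].
  have [u gu] := same_image_perm fi gi gT.
  have {gu} gu : g = c u by apply/ffunP => i; rewrite ffunE gu.
  exists u => //; rewrite inE; apply/eqP.
  by apply: (imset_inj (imset_inj fi)); rewrite -cE -gu.
case=> u; rewrite inE => /eqP uQ ->{g}; split; last by rewrite /F cT cE uQ.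
rewrite inE cT fV andbT; apply/embeddingsP; split.
  by move=> i j; rewrite !ffunE => /fi /perm_inj.
by move=> e eQ; rewrite cimg; apply: fQ; rewrite -uQ; apply/imsetP; exists e.
Qed.

Lemma card_embeddings (T : finType) (s : nat) (Q : {set {set 'I_s}})
    (E : {set {set T}}) :
  #|embeddings Q E| = (#|automorphisms Q| * Ncopies Q [set: T] E)%N.
Proof.
rewrite -card_embeddings_in; apply: eq_card => f.
by rewrite [in RHS]inE finset.subsetT andbT.
Qed.

(** Group the embeddings by their vertex set [I]: each group has [#|automorphisms Q|] times as many
    members as there are copies in [H[I]], all with the same monomial. Sums over maps, unlike sums
    over sets, can be sampled. *)
Lemma PQH_embeddings (R : realType) (n s : nat) (Q : {set {set 'I_s}})
    (E : {set {set 'I_n}}) (x : 'I_n -> R) :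
  PQH Q E x = (s`!)%:R / #|automorphisms Q|%:R *
    \sum_(f in embeddings Q E) \prod_k x (f k).
Proof.
rewrite /PQH -mulrA; congr (_ * _).
have c0 : (#|automorphisms Q|%:R : R) != 0.
  by rewrite pnatr_eq0 -lt0n card_automorphisms_gt0.
have cardim f : f \in embeddings Q E -> #|f @: [set: 'I_s]| == s.
  by move=> /embeddingsP[fi _]; rewrite card_imset // cardsT card_ord.
rewrite (partition_big (fun f : {ffun 'I_s -> 'I_n} => f @: [set: 'I_s])
  (fun I : {set 'I_n} => #|I| == s)) //=.
rewrite mulr_sumr; apply: eq_bigr => I /eqP Is.
apply: (mulfI c0); rewrite mulrA -natrM -card_embeddings_in mulVKf //.
rewrite -sum1_card natr_sum mulr_suml.
have DE f : (f \in [set f in embeddings Q (Defs.induced I E) |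
                     f @: [set: 'I_s] \subset I])
    = (f \in embeddings Q E) && (f @: [set: 'I_s] == I).
  rewrite inE; apply/andP/andP => -[/embeddingsP[fi fQ] fI].
    split; last by rewrite eqEcard fI Is card_imset // cardsT card_ord /=.
    by apply/embeddingsP; split=> // e /fQ; rewrite inE => /andP[].
  split; last by rewrite (eqP fI).
  apply/embeddingsP; split=> // e /fQ fe; rewrite inE fe -(eqP fI).
  exact/imsetS/finset.subsetT.
rewrite (eq_bigl _ _ DE); apply: eq_bigr => f /andP[/embeddingsP[fi _] /eqP <-].
rewrite mul1r big_imset /=; last by move=> i j _ _; apply: fi.
by apply: eq_bigl => i; rewrite inE.
Qed.

(** * Independent sampling of vertices *)

Lemma sum_prod_marginal (R : comPzRingType) (J K V : finType) (y : V -> R)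
    (h : K -> J) (g : K -> V) :
  \sum_v y v = 1 -> injective h ->
  \sum_(f : {ffun J -> V} | [forall k, f (h k) == g k]) \prod_j y (f j)
    = \prod_k y (g k).
Proof.
move=> y1 hi.
(* Values allowed at coordinate [j]: only [g k] if [j = h k], anything outside the image of [h]. The
   sum factors over coordinates, and each free one contributes the total mass 1. *)
pose Q j : pred V := [pred v | [forall k, (h k == j) ==> (v == g k)]].
have -> : \sum_(f : {ffun J -> V} | [forall k, f (h k) == g k]) \prod_j y (f j)
    = \prod_j \sum_(v | Q j v) y v.
  rewrite bigA_distr_big_dep; apply: eq_bigl => f.
  apply/forallP/familyP => /= H.
    by move=> j; rewrite inE; apply/forallP => k; apply/implyP => /eqP <-.
  by move=> k; move: (H (h k)); rewrite inE => /forallP/(_ k); rewrite eqxx.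
rewrite (bigID (fun j => j \in h @: [set: K])) /= [X in _ * X]big1 ?mulr1; last first.
  move=> j jh; rewrite -[RHS]y1; apply: eq_bigl => v.
  apply/forallP => k; apply/implyP => /eqP hk.
  by rewrite -hk imset_f ?inE in jh.
rewrite big_imset /=; last by move=> ? ? _ _; apply: hi.
apply: eq_big => [k|k _]; first by rewrite inE.
apply: big_pred1 => v /=; apply/forallP/eqP => [/(_ k)|-> j].
  by rewrite eqxx => /eqP.
by apply/implyP => /eqP /hi ->.
Qed.

Section Sampling.
Variables (R : realType) (V : finType) (y : V -> R) (d : R).
Hypotheses (y0 : forall v, 0 <= y v) (y1 : \sum_v y v = 1)
  (yd : forall v, y v <= d).

(** Union bound over ordered pairs of coordinates: a given pair collides with probability
    [\sum_v y v * y v <= d]. *)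
Lemma sum_prod_noninjective (m : nat) :
  \sum_(f : {ffun 'I_m -> V} | ~~ injectiveb f) \prod_j y (f j)
    <= (m ^ 2)%:R * d.
Proof.
have w0 (f : {ffun 'I_m -> V}) : 0 <= \prod_j y (f j) by apply: prodr_ge0.
have coll (i j : 'I_m) : i != j ->
    \sum_(f : {ffun 'I_m -> V} | f i == f j) \prod_j y (f j) <= d.
  move=> ij; rewrite (partition_big (fun f : {ffun 'I_m -> V} => f i) xpredT) //=.
  rewrite -[d]mul1r -[X in X * d]y1 mulr_suml; apply: ler_sum => v _.
  (* Indexing the pair by [bool] makes the event that both coordinates equal [v] a marginal, of mass
     [y v * y v]. *)
  pose h b : 'I_m := if b then i else j.
  have hi : injective h.
    by case=> -[] //= e; move: ij; rewrite -?e ?eqxx // e eqxx.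
  have := sum_prod_marginal (fun=> v) y1 hi.
  rewrite big_bool /= => E; apply: le_trans (ler_wpM2l (y0 v) (yd v)).
  rewrite -E le_eqVlt; apply/orP; left; apply/eqP; apply: eq_bigl => f.
  apply/andP/forallP => [[/eqP fij /eqP fi] []|H] /=; rewrite ?fi -?fij ?fi //.
  by rewrite (eqP (H true)) (eqP (H false)).
have d0 : 0 <= d.
  have [v _|V0] := pickP (fun _ : V => true); first exact: le_trans (y0 v) (yd v).
  by move: y1; rewrite big_pred0 // => /esym /eqP; rewrite oner_eq0.
apply: (@le_trans _ _ (\sum_(ij : 'I_m * 'I_m | ij.1 != ij.2)
    \sum_(f : {ffun 'I_m -> V} | f ij.1 == f ij.2) \prod_j y (f j))).
  under [leRHS]eq_bigr do rewrite big_mkcond /=.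
  rewrite exchange_big /= big_mkcond /=; apply: ler_sum => f _.
  have nn (ij : 'I_m * 'I_m) : 0 <= if f ij.1 == f ij.2 then \prod_j y (f j) else 0.
    by case: ifP.
  case: ifPn => [/injectivePn[i [j ij fij]]|_]; last by apply: sumr_ge0.
  by rewrite (bigD1 (i, j)) //= fij eqxx lerDl; apply: sumr_ge0.
apply: (@le_trans _ _ (\sum_(ij : 'I_m * 'I_m) d)).
  rewrite big_mkcond /=; apply: ler_sum => -[i j] _ /=.
  by case: ifP => // /coll.
by rewrite sumr_const card_prod card_ord mulr_natl.
Qed.

(* Sample [m] vertices independently from [y]: each placement [h] of
   [{0..s-1}] into the sample is an embedding of [Q] with probability
   [\sum_(g in embeddings Q E) \prod_k y (g k)]. *)
Lemma sum_embeddings_sampling (m s : nat) (Q : {set {set 'I_s}})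
    (E : {set {set V}}) (B : R) :
  0 <= B ->
  (forall f : {ffun 'I_m -> V}, injective f ->
     #|embeddings Q [set e : {set 'I_m} | f @: e \in E]|%:R <= B) ->
  (m ^_ s)%:R * \sum_(g in embeddings Q E) \prod_k y (g k)
    <= B + (m ^_ s)%:R * ((m ^ 2)%:R * d).
Proof.
move=> B0 HB.
pose w (f : {ffun 'I_m -> V}) := \prod_j y (f j).
pose H := [set h : {ffun 'I_s -> 'I_m} | injectiveb h].
have w0 f : 0 <= w f by apply: prodr_ge0.
have w1 : \sum_f w f = 1.
  by rewrite /w -(bigA_distr_bigA (fun _ v => y v)) /= big1.
pose good (f : {ffun 'I_m -> V}) (h : {ffun 'I_s -> 'I_m}) :=
  [ffun k => f (h k)] \in embeddings Q E.
(* Both sides are the expected number of injective placements [h] for which [f \o h] is an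
   embedding. *)
have -> : (m ^_ s)%:R * \sum_(g in embeddings Q E) \prod_k y (g k)
    = \sum_f w f * #|[set h in H | good f h]|%:R.
  have <- : #|H| = (m ^_ s)%N by rewrite card_inj_ffuns !card_ord.
  transitivity (\sum_(h in H) \sum_(f | good f h) w f).
    rewrite mulr_natl -sumr_const; apply: eq_bigr => h; rewrite inE => /injectiveP hi.
    rewrite [RHS](partition_big (fun f : {ffun 'I_m -> V} => [ffun k => f (h k)])
      (fun g => g \in embeddings Q E)) //=.
    apply: eq_bigr => g gE; rewrite -(sum_prod_marginal g y1 hi).
    apply: eq_bigl => f; apply/forallP/andP => [fg|[_ /eqP <-] k].
      have fhg : [ffun k => f (h k)] = g.
        by apply/ffunP => k; rewrite ffunE (eqP (fg k)).
      by rewrite /good fhg.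
    by rewrite ffunE.
  rewrite (exchange_big_dep xpredT) //=; apply: eq_bigr => f _.
  rewrite -sum1_card natr_sum mulr_sumr; apply: eq_big => [h|h _]; last by rewrite mulr1.
  by rewrite [RHS]inE.
(* If [f] is injective, every good [h] embeds [Q] in the pulled-back graph, so [B] bounds their
   number. Otherwise all [m ^_ s] placements are conceded, and collisions are rare. *)
rewrite (bigID (fun f : {ffun 'I_m -> V} => injectiveb f)) /=; apply: lerD.
  apply: (@le_trans _ _ (\sum_(f : {ffun 'I_m -> V} | injectiveb f) w f * B)).
    apply: ler_sum => f /injectiveP fi; apply: ler_wpM2l => //.
    apply: le_trans (HB f fi); rewrite ler_nat.
    apply/subset_leq_card/fintype.subsetP => h.
    rewrite inE => /andP[hH /embeddingsP[_ hQ]].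
    rewrite inE in hH; apply/embeddingsP; split; first exact/injectiveP.
    move=> e /hQ fhe; rewrite inE -imset_comp.
    suff <- : [ffun k => f (h k)] @: e = (f \o h) @: e by [].
    by apply: eq_imset => k; rewrite ffunE.
  rewrite -mulr_suml -[leRHS]mul1r ler_wpM2r // -w1.
  by rewrite [leRHS](bigID (fun f : {ffun 'I_m -> V} => injectiveb f)) /= lerDl sumr_ge0.
apply: (@le_trans _ _ (\sum_(f : {ffun 'I_m -> V} | ~~ injectiveb f) (m ^_ s)%:R * w f)).
  apply: ler_sum => f _; rewrite mulrC ler_wpM2r // ler_nat.
  rewrite (_ : m ^_ s = #|H|)%N; last by rewrite card_inj_ffuns !card_ord.
  by apply/subset_leq_card/fintype.subsetP => h; rewrite inE => /andP[].
by rewrite -mulr_sumr ler_wpM2l // sum_prod_noninjective.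
Qed.
End Sampling.

(** * Suprema, and the sampling bound in terms of [ex_n] *)

Local Open Scope classical_set_scope.
Local Open Scope ring_scope.

(** [sup] of the empty set is 0, hence the sign condition on [B]. *)
Lemma sup_le_nneg (R : realType) (S : set R) (B : R) :
  0 <= B -> (forall x, S x -> x <= B) -> sup S <= B.
Proof.
move=> B0 SB; have [->|/set0P S0] := eqVneq S set0; first by rewrite sup0.
exact: ge_sup.
Qed.

Lemma sup_nneg (R : realType) (S : set R) :
  (forall x, S x -> 0 <= x) -> 0 <= sup S.
Proof.
move=> S0; have [supS|/sup_out -> //] := pselect (has_sup S).
have [[x Sx] _] := supS; apply: le_trans (S0 x Sx) _.
exact: sup_upper_bound.
Qed.

Section Density.
Variables (R : realType) (s : nat) (Q : {set {set 'I_s}}) (P : property).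
Hypothesis Ppullback : forall m n (f : 'I_m -> 'I_n) E,
  injective f -> P E -> P (pullback f E).

Lemma ex_n_ge0 n : 0 <= ex_n R Q P n.
Proof. by apply: sup_nneg => _ [E _ <-]; rewrite ler0n. Qed.

Lemma Ncopies_le_ex_n n E : P E ->
  (Ncopies Q [set: 'I_n]%SET E)%:R <= ex_n R Q P n.
Proof.
move=> PE; apply: ub_le_sup; last by exists E.
exists #|{: {set 'I_n} * {set {set 'I_n}}}|%:R => _ [F _ <-].
by rewrite ler_nat max_card.
Qed.

(** By orbit-stabiliser, the number of distinct relabellings of [Q] on its own vertex set. *)
Definition embedding_weight : R := s`!%:R / #|automorphisms Q|%:R.

Lemma embedding_weight_ge0 : 0 <= embedding_weight.
Proof. by rewrite /embedding_weight divr_ge0. Qed.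

Lemma ffact_bin (m : nat) : (m ^_ s)%:R = 'C(m, s)%:R * s`!%:R :> R.
Proof. by rewrite -natrM bin_ffact. Qed.

(** The sampling bound with [B = #|automorphisms Q| * ex_n R Q P m]: an injective sample spans a
    member of [P] on [m] vertices. Dividing by [m ^_ s = 'C(m, s) * s!] leaves the density. *)
Lemma PQH_le_ex_n (m n : nat) (E : {set {set 'I_n}}) (y : 'I_n -> R) (d : R) :
  (s <= m)%N -> P E -> (forall i, 0 <= y i) -> \sum_i y i = 1 ->
  (forall i, y i <= d) ->
  PQH Q E y <= ex_n R Q P m / 'C(m, s)%:R + embedding_weight * (m ^ 2)%:R * d.
Proof.
move=> sm PE y0 y1 yd.
have c0 : 0 < #|automorphisms Q|%:R :> R by rewrite ltr0n card_automorphisms_gt0.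
have C0 : 0 < 'C(m, s)%:R :> R by rewrite ltr0n bin_gt0.
have s0 : 0 < s`!%:R :> R by rewrite ltr0n fact_gt0.
have B0 : 0 <= #|automorphisms Q|%:R * ex_n R Q P m by rewrite mulr_ge0 ?ex_n_ge0.
have := sum_embeddings_sampling y0 y1 yd B0 (m := m) (Q := Q) (E := E).
rewrite PQH_embeddings -/embedding_weight; set H := \sum_(g in _) _ => /(_ _) HB.
have {HB} : (m ^_ s)%:R * H <= #|automorphisms Q|%:R * ex_n R Q P m
    + (m ^_ s)%:R * ((m ^ 2)%:R * d).
  apply: HB => f fi; rewrite card_embeddings natrM ler_pM2l //.
  by apply: Ncopies_le_ex_n; apply: Ppullback.
rewrite ffact_bin => HB.
have Cs0 : 0 < 'C(m, s)%:R * s`!%:R :> R by rewrite mulr_gt0.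
rewrite mulrC -ler_pdivlMr // in HB.
apply: le_trans (ler_wpM2l embedding_weight_ge0 HB) _.
rewrite le_eqVlt; apply/orP; left; apply/eqP; rewrite /embedding_weight; field.
by rewrite !gt_eqF.
Qed.

Lemma PQH_le_norm n (E : {set {set 'I_n}}) (x : 'I_n -> R) :
  PQH Q E x <= PQH Q E (fun i => `|x i|).
Proof.
apply: ler_wpM2l => //; apply: ler_sum => I _; apply: ler_wpM2l => //.
by rewrite -normr_prod ler_norm.
Qed.

Lemma PQH_scale n (E : {set {set 'I_n}}) (x : 'I_n -> R) (a : R) :
  PQH Q E (fun i => a * x i) = a ^+ s * PQH Q E x.
Proof.
rewrite /PQH mulrCA; congr (_ * _); rewrite mulr_sumr; apply: eq_bigr => I /eqP Is.
by rewrite big_split /= prodr_const Is mulrCA.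
Qed.

(** * Vectors of unit p-norm *)

Variable p : R.
Hypothesis p1 : 1 < p.

Let p0 : 0 < p. Proof. exact: lt_trans p1. Qed.

Lemma pnorm1_sum n (x : 'I_n -> R) : pnorm p x = 1 -> \sum_i `|x i| `^ p = 1.
Proof.
move=> x1; have sge0 : 0 <= \sum_i `|x i| `^ p by apply: sumr_ge0 => i _; apply: powR_ge0.
have -> : \sum_i `|x i| `^ p = pnorm p x `^ p.
  by rewrite /pnorm -powRrM mulVf ?lt0r_neq0 // powRr1.
by rewrite x1 powR1.
Qed.

(* Young's inequality against the constant vector of unit conjugate norm. *)
Lemma sum_le_pnorm1 n (x : 'I_n -> R) : pnorm p x = 1 ->
  \sum_i `|x i| <= n%:R `^ (1 - p^-1).
Proof.
move=> /pnorm1_sum x1.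
have q0 : 0 < 1 - p^-1 by rewrite subr_gt0 invf_lt1.
have [n0|n0] := posnP n.
  move: x1; case: _ / (esym n0) x => x.
  by rewrite big_ord0 => /esym/eqP; rewrite oner_eq0.
have nn : 0 < n%:R :> R by rewrite ltr0n.
pose b : R := n%:R `^ (- (1 - p^-1)).
have b0 : 0 < b by rewrite powR_gt0.
have -> : n%:R `^ (1 - p^-1) = b^-1 :> R by rewrite /b powRN invrK.
rewrite -[leRHS]mul1r ler_pdivlMr // mulr_suml.
have young i : `|x i| * b <= `|x i| `^ p / p + b `^ (1 - p^-1)^-1 / (1 - p^-1)^-1.
  by apply: conjugate_powR; rewrite ?normr_ge0 ?ltW ?invr_gt0 // invrK addrC subrK.
apply: le_trans (ler_sum _ (fun i _ => young i)) _.
rewrite big_split /= -mulr_suml x1 sumr_const card_ord invrK /b -powRrM.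
rewrite mulNr divff ?gt_eqF // powR_inv1 ?ler0n //.
by rewrite -[_ *+ n]mulr_natl mulrA divff ?gt_eqF // !mul1r addrC subrK.
Qed.

Lemma le1_pnorm1 n (x : 'I_n -> R) i : pnorm p x = 1 -> `|x i| <= 1.
Proof.
move=> /pnorm1_sum x1; rewrite leNgt; apply/negP => xi.
have : 1 < `|x i| `^ p.
  have := gt0_ltr_powR p0 (_ : 1 \in Num.nneg) (_ : `|x i| \in Num.nneg) xi.
  by rewrite powR1 !nnegrE ler01 normr_ge0; apply.
apply/negP; rewrite -leNgt -x1 (bigD1 i) //= lerDl.
by apply: sumr_ge0 => j _; apply: powR_ge0.
Qed.

(** Entries are at most 1 in absolute value and [p > 1], so raising them to the power [p] only
    decreases them. *)
Lemma sum_ge1_pnorm1 n (x : 'I_n -> R) : pnorm p x = 1 -> 1 <= \sum_i `|x i|.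
Proof.
move=> x1; rewrite -[X in X <= _](pnorm1_sum x1); apply: ler_sum => i _.
have [->|xi] := eqVneq `|x i| 0; first by rewrite powR0 ?gt_eqF.
rewrite -[leRHS]powRr1 //; apply: ger_powR (ltW p1).
by rewrite lt_neqAle eq_sym xi normr_ge0 le1_pnorm1.
Qed.

(* Normalising [|x|] to a probability [y] costs a factor [X ^+ s] with
   [X <= S := n `^ (1 - 1/p)], while [max y <= X^-1]; as [s >= 1], the error
   term [X ^+ s * X^-1] is of lower order than [S ^+ s]. *)
Lemma PQH_le_pnorm1 (m n : nat) (E : {set {set 'I_n}}) (x : 'I_n -> R) :
  (0 < s)%N -> (s <= m)%N -> P E -> pnorm p x = 1 ->
  PQH Q E x <= (n%:R `^ (1 - p^-1)) ^+ s *
    (ex_n R Q P m / 'C(m, s)%:R + embedding_weight * (m ^ 2)%:R / n%:R `^ (1 - p^-1)).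
Proof.
move=> s0 sm PE x1; set S := n%:R `^ _.
have X1 := sum_ge1_pnorm1 x1; have XS := sum_le_pnorm1 x1.
rewrite -/S in XS; set X := \sum_i _ in X1 XS.
have X0 : 0 < X by apply: lt_le_trans X1.
have S0 : 0 < S by apply: lt_le_trans XS.
apply: le_trans (PQH_le_norm _ _) _.
have -> : PQH Q E (fun i => `|x i|) = X ^+ s * PQH Q E (fun i => X^-1 * `|x i|).
  by rewrite PQH_scale mulrA -exprMn divff ?gt_eqF // expr1n mul1r.
have y0 i : 0 <= X^-1 * `|x i| by rewrite mulr_ge0 // invr_ge0 ltW.
have y1 : \sum_i X^-1 * `|x i| = 1 by rewrite -mulr_sumr mulVf ?gt_eqF.
have yd i : X^-1 * `|x i| <= X^-1.
  by rewrite -[leRHS]mulr1 ler_wpM2l ?invr_ge0 ?(ltW X0) //; apply: le1_pnorm1.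
apply: le_trans (ler_wpM2l _ (PQH_le_ex_n sm PE y0 y1 yd)) _.
  by rewrite exprn_ge0 // ltW.
have a0 : 0 <= ex_n R Q P m / 'C(m, s)%:R by rewrite divr_ge0 ?ex_n_ge0.
have w0 : 0 <= embedding_weight * (m ^ 2)%:R by rewrite mulr_ge0 ?embedding_weight_ge0.
have pow (z : R) : 0 < z -> z ^+ s / z = z ^+ s.-1.
  by move=> z0; rewrite -[in LHS](prednK s0) exprSr mulfK ?gt_eqF.
rewrite !mulrDr; apply: lerD.
  by rewrite ler_wpM2r // lerXn2r ?nnegrE ?(ltW X0) ?(ltW S0).
rewrite mulrCA [leRHS]mulrCA ler_wpM2l // !pow //.
by rewrite lerXn2r ?nnegrE ?(ltW X0) ?(ltW S0).
Qed.
End Density.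

(** * Convergence of the two sequences *)

Lemma ffact_div_expn_cvg (R : realType) (s : nat) :
  (fun n : nat => (n ^_ s)%:R / n%:R ^+ s : R) @ \oo --> (1 : R).
Proof.
elim: s => [|s IHs].
  rewrite (_ : (fun n : nat => _) = cst 1) ?funeqE => [|n].
    exact: cvg_cst.
  by rewrite ffactn0 expr0 divr1.
(* Going from [s] to [s.+1] multiplies the ratio by [(n - s) / n]; the truncated subtraction is
   harmless once [s <= n]. *)
suff H : (fun n : nat => (n - s)%:R / n%:R : R) @ \oo --> (1 : R).
  rewrite -[X in _ --> X]mulr1; apply: cvg_trans (cvgM IHs H).
  apply: near_eq_cvg; near=> n; rewrite /= ffactnSr natrM exprSr invfM.
  by rewrite mulrACA.
have H0 : (fun n : nat => 1 - s%:R * n%:R^-1 : R) @ \oo --> (1 : R).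
  rewrite -[X in _ --> X]subr0 -[X in _ - X](mulr0 s%:R).
  apply: cvgB; first exact: cvg_cst.
  apply: cvgMl_tmp; apply/gtr0_cvgV0; last exact: cvgr_idn.
  by near=> n; rewrite ltr0n; near: n; exists 1%N.
apply: cvg_trans H0; apply: near_eq_cvg; near=> n.
have n0 : (0 < n)%N by near: n; exists 1%N.
have sn : (s <= n)%N by near: n; exists s.
by rewrite natrB // mulrBl divff // pnatr_eq0 -lt0n.
Unshelve. all: by end_near. Qed.

(** The limit is the infimum of [a m] over [s <= m]. Fixing a nearly optimal [m] bounds [b] above,
    and [k n * inf A <= k n * a n <= b n] bounds it below; then [a] is squeezed between [inf A] and
    [b / k]. *)
Lemma sandwich_cvg (R : realType) (s : nat) (a b k : nat -> R) :
  (forall n, 0 <= a n) -> (forall n, 0 <= k n) -> k @ \oo --> (1 : R) ->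
  (\forall n \near \oo, k n * a n <= b n) ->
  (forall m e, (s <= m)%N -> 0 < e -> \forall n \near \oo, b n <= a m + e) ->
  exists l : R, a @ \oo --> l /\ b @ \oo --> l.
Proof.
move=> a0 k0 k1 kab bae; pose A := [set a m | m in [set m | (s <= m)%N]].
have A0 : A !=set0 by exists (a s), s => //=.
have lbA : has_lbound A by exists 0 => _ [m _ <-].
have la m : (s <= m)%N -> inf A <= a m by move=> sm; apply: ge_inf => //; exists m.
have bl : b @ \oo --> inf A.
  have kl : (fun n => k n * inf A) @ \oo --> inf A.
    by rewrite -[X in _ --> X]mul1r; apply: cvgMr_tmp.
  apply/cvgrPdist_le => e e0; have e2 : 0 < e / 2 by rewrite divr_gt0.
  have [_ [m /= sm <-] am] := inf_adherent e2 (conj A0 lbA).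
  move/cvgrPdist_le : kl => /(_ _ e0) kl.
  near=> n; rewrite ler_distlC; apply/andP; split.
    apply: (@le_trans _ _ (k n * inf A)).
      have : `|inf A - k n * inf A| <= e by near: n.
      by rewrite ler_distlC => /andP[].
    apply: (@le_trans _ _ (k n * a n)); last by near: n.
    by apply: ler_wpM2l => //; apply: la; near: n; exists s.
  have : b n <= a m + e / 2 by near: n; apply: bae.
  by move=> /le_trans -> //; move: (ltW am); lra.
exists (inf A); split=> //.
have bk : (fun n => b n / k n) @ \oo --> inf A.
  by rewrite -[X in _ --> X]divr1; apply: cvgM => //; apply: cvgV => //; exact: oner_neq0.
apply: squeeze_cvgr (cvg_cst (inf A)) bk; near=> n; apply/andP; split.
  by apply: la; near: n; exists s.
have kn : 0 < k n.
  by near: n; apply: cvgr_gt k1 _ _.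
by rewrite ler_pdivlMr // mulrC; near: n.
Unshelve. all: by end_near. Qed.

Section Limits.
Variables (R : realType) (s : nat) (Q : {set {set 'I_s}}) (P : property) (p : R).
Hypothesis Ppullback : forall m n (f : 'I_m -> 'I_n) E,
  injective f -> P E -> P (pullback f E).
Hypothesis s0 : (0 < s)%N.
Hypothesis p1 : 1 < p.

Let S (n : nat) : R := n%:R `^ (1 - p^-1).

Let bound (m n : nat) : R :=
  ex_n R Q P m / 'C(m, s)%:R + embedding_weight R Q * (m ^ 2)%:R / S n.

Let S_ge0 n : 0 <= S n. Proof. exact: powR_ge0. Qed.

Let bound_ge0 m n : 0 <= S n ^+ s * bound m n.
Proof.
rewrite mulr_ge0 ?exprn_ge0 // addr_ge0 // divr_ge0 ?ex_n_ge0 //.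
by rewrite mulr_ge0 ?embedding_weight_ge0.
Qed.

Lemma lambda_p_le m n (E : {set {set 'I_n}}) : (s <= m)%N -> P E ->
  lambda_p Q E p <= S n ^+ s * bound m n.
Proof.
move=> sm PE; apply: sup_le_nneg => // _ [x /= x1 <-].
exact: PQH_le_pnorm1.
Qed.

Lemma lambda_Pn_le m n : (s <= m)%N ->
  lambda_Pn Q P p n <= S n ^+ s * bound m n.
Proof.
by move=> sm; apply: sup_le_nneg => // _ [E PE <-]; apply: lambda_p_le.
Qed.

Lemma lambda_p_ge n (E : {set {set 'I_n}}) : (0 < n)%N -> P E ->
  s`!%:R * (Ncopies Q [set: 'I_n]%SET E)%:R * (n%:R `^ (- p^-1)) ^+ s
    <= lambda_p Q E p.
Proof.
move=> n0 PE; have nn : 0 < n%:R :> R by rewrite ltr0n.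
have c0 : #|automorphisms Q|%:R != 0 :> R.
  by rewrite pnatr_eq0 -lt0n card_automorphisms_gt0.
apply: ub_le_sup.
  (* Only boundedness is wanted here, so the smallest admissible sample size [m = s] will do. *)
  exists (S n ^+ s * bound s n) => _ [x /= x1 <-].
  exact: PQH_le_pnorm1.
(* The constant vector of unit p-norm: every embedding has weight [n^(-s/p)]. *)
exists (fun=> n%:R `^ (- p^-1)) => /=.
  rewrite /pnorm (eq_bigr (fun=> n%:R^-1)) => [|i _]; last first.
    rewrite ger0_norm ?powR_ge0 // -powRrM mulNr mulVf ?gt_eqF ?powR_inv1 ?ler0n //.
    exact: lt_trans p1.
  by rewrite sumr_const card_ord -[_^-1 *+ n]mulr_natl divff ?gt_eqF // powR1.
rewrite PQH_embeddings /= prodr_const card_ord.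
rewrite sumr_const card_embeddings -[_ *+ (_ * _)]mulr_natl natrM; field.
by [].
Qed.

Lemma lambda_Pn_ge n : (0 < n)%N ->
  s`!%:R * ex_n R Q P n * (n%:R `^ (- p^-1)) ^+ s <= lambda_Pn Q P p n.
Proof.
move=> n0; have nn : 0 < n%:R :> R by rewrite ltr0n.
have w0 : 0 < s`!%:R * (n%:R `^ (- p^-1)) ^+ s :> R.
  by rewrite mulr_gt0 ?exprn_gt0 ?powR_gt0 // ltr0n fact_gt0.
(* The positive factor is moved to the right so that the supremum [ex_n] stands alone and can be
   bounded member by member. *)
rewrite mulrAC mulrC -ler_pdivlMr //; apply: sup_le_nneg.
  rewrite divr_ge0 ?(ltW w0) //; apply: sup_nneg => _ [E PE <-].
  by apply: le_trans (lambda_p_ge n0 PE); rewrite !mulr_ge0 ?exprn_ge0 ?powR_ge0.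
move=> _ [E PE <-]; rewrite ler_pdivlMr // mulrC mulrAC.
apply: le_trans (lambda_p_ge n0 PE) _; apply: ub_le_sup; last by exists E.
by exists (S n ^+ s * bound s n) => _ [F PF <-]; apply: lambda_p_le.
Qed.

(** As [s/p - s = - s (1 - 1/p)], the normalisation cancels exactly the factor [S n ^+ s] of the
    upper bound. *)
Lemma powR_scaleE n : (0 < n)%N -> n%:R `^ (s%:R / p - s%:R) = (S n ^+ s)^-1 :> R.
Proof.
move=> n0; rewrite /S -powR_mulrn ?powR_ge0 // -powRrM -powRN; congr (_ `^ _).
by rewrite mulrBl mul1r opprB mulrC.
Qed.

Lemma S_cvgy (A : R) : \forall n \near \oo, A <= S n.
Proof.
have q0 : 0 < 1 - p^-1 by rewrite subr_gt0 invf_lt1 // (lt_trans _ p1).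
near=> n; apply: le_trans (ler_norm A) _.
have -> : `|A| = (`|A| `^ (1 - p^-1)^-1) `^ (1 - p^-1).
  by rewrite -powRrM mulVf ?gt_eqF // powRr1.
apply: ge0_ler_powR; rewrite ?nnegrE ?powR_ge0 ?ler0n ?(ltW q0) //.
by near: n; apply: nbhs_infty_ger.
Unshelve. all: by end_near. Qed.

Lemma lambda_ex_cvg : exists l : R,
  ((fun n : nat => ex_n R Q P n / ('C(n, s))%:R) @ \oo --> l) /\
  ((fun n : nat => lambda_Pn Q P p n * (n%:R `^ (s%:R / p - s%:R))) @ \oo --> l).
Proof.
apply: (sandwich_cvg (s := s) (k := fun n => (n ^_ s)%:R / n%:R ^+ s)).
- by move=> n; rewrite divr_ge0 ?ex_n_ge0.
- by move=> n; rewrite divr_ge0 ?exprn_ge0.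
- exact: ffact_div_expn_cvg.
- near=> n; have n0 : (0 < n)%N by near: n; exists 1%N.
  have sn : (s <= n)%N by near: n; exists s.
  have nn : 0 < n%:R :> R by rewrite ltr0n.
  have Sn : 0 < S n by rewrite powR_gt0.
  rewrite powR_scaleE // ler_pdivlMr ?exprn_gt0 //.
  apply: le_trans (lambda_Pn_ge n0); rewrite le_eqVlt; apply/orP; left; apply/eqP.
  (* This turns the constant-vector bound into [S n ^+ s] times [(n ^_ s / n ^ s) * (ex_n R Q P n /
     'C(n, s))]. *)
  have -> : n%:R `^ (- p^-1) = S n / n%:R.
    rewrite /S powRD; last by apply/implyP => _; rewrite gt_eqF.
    by rewrite powRr1 ?ler0n // mulrAC divff ?mul1r ?gt_eqF.
  rewrite ffact_bin exprMn exprVn; field.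
  by rewrite expf_neq0 ?pnatr_eq0 -?lt0n ?n0 ?bin_gt0.
- move=> m e sm e0; near=> n; have n0 : (0 < n)%N by near: n; exists 1%N.
  have Sn : 0 < S n by rewrite powR_gt0 // ltr0n.
  rewrite powR_scaleE // ler_pdivrMr ?exprn_gt0 // mulrC.
  apply: le_trans (lambda_Pn_le n sm) _; rewrite ler_wpM2l ?exprn_ge0 ?(ltW Sn) //.
  (* With [m] and [e] fixed, the collision error drops below [e] as soon as [S n] exceeds a
     constant. *)
  rewrite lerD2l ler_pdivrMr // [leRHS]mulrC -ler_pdivrMr //.
  by near: n; apply: S_cvgy.
Unshelve. all: by end_near. Qed.
End Limits.

Theorem theorem3p3 (R : realType) (r s : nat) (Q : {set {set 'I_s}})
    (P : property) (p : R) :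
  (2 <= r)%N -> (r <= s)%N -> uniform r Q -> hereditary_property r P ->
  1 < p ->
  exists l : R,
    ((fun n : nat => ex_n R Q P n / ('C(n, s))%:R) @ \oo --> l) /\
    ((fun n : nat => lambda_Pn Q P p n * (n%:R `^ (s%:R / p - s%:R))) @ \oo --> l).
Proof.
move=> r2 rs _ [_ _ Ppullback _] p1.
by apply: lambda_ex_cvg => //; apply: leq_trans (ltnW r2) rs.
Qed.
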